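(* Let $\mathcal V$ be a variety that has a Taylor term. The following properties of $\mathcal V$ are equivalent: (1) $\mathcal V$ has a difference term. (2) The centralizer relation is weakly stable under lifting in its third place throughout $\mathcal V$: for every $\mathbf A\in\mathcal V$ and all $x,y,z,z'\in\mathrm{Con}(\mathbf A)$, if $C(x,y;z)$ and $z\leq z'\leq x\cap y$, then $C(x,y;z')$.
   Context: A variety is an equationally defined class of algebras of a fixed (arbitrary) signature. $\mathrm{Con}(\mathbf A)$ is the congruence lattice of $\mathbf A$, with meet $\cap$, join $+$, and least element $0$ (the equality relation). For $\alpha,\beta\in\mathrm{Con}(\mathbf A)$, an $\alpha,\beta$-matrix is a matrix $\begin{bmatrix}p&q\\ r&s\end{bmatrix}=\begin{bmatrix}t(\mathbf a,\mathbf u)&t(\mathbf a,\mathbf v)\\ t(\mathbf b,\mathbf u)&t(\mathbf b,\mathbf v)\end{bmatrix}$, where $t$ is an $(m+n)$-ary term operation of $\mathbf A$, $(a_i,b_i)\in\alpha$ for all $i$ and $(u_j,v_j)\in\beta$ for all $j$. For $\delta\in\mathrm{Con}(\mathbf A)$, the centralizer relation $C(\alpha,\beta;\delta)$ holds if for every $\alpha,\beta$-matrix $\begin{bmatrix}p&q\\ r&s\end{bmatrix}$, $(p,q)\in\delta$ implies $(r,s)\in\delta$. The commutator $[\alpha,\beta]$ is the least congruence $\delta$ such that $C(\alpha,\beta;\delta)$ holds. A congruence $\alpha$ is abelian if $[\alpha,\alpha]=0$. A Taylor term for $\mathcal V$ is a term $T(x_1,\ldots,x_n)$ such that $\mathcal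 V\models T(x,\ldots,x)\approx x$ and, for each $i\in\{1,\ldots,n\}$, $\mathcal V$ satisfies some identity $T(\mathbf w)\approx T(\mathbf z)$ where $\mathbf w,\mathbf z$ are $n$-tuples of variables and $w_i\neq z_i$ are different variables. A difference term for $\mathcal V$ is a ternary term $t(x,y,z)$ such that $\mathcal V\models t(x,x,y)\approx y$ and, for every $\mathbf B\in\mathcal V$, $t^{\mathbf B}(a,b,b)=a$ whenever $(a,b)$ is contained in an abelian congruence of $\mathbf B$. *)

(* Defs.v *)
(* Finitary universal algebra on top of MathComp, with the classical axioms of
   mathcomp.classical.boolp. *)
From mathcomp Require Import all_boot boolp.

Set Implicit Arguments.
Unset Strict Implicit.
Unset Printing Implicit Defensive.

Record signature := Signature { sym : Type; arity : sym -> nat }.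

(* The empty carrier is not excluded; it occurs only when there are no
   constants, and every identity and every centralizer condition then holds
   vacuously in it. *)
Record algebra (S : signature) := Algebra {
  carrier :> Type;
  op : forall f : sym S, ('I_(arity f) -> carrier) -> carrier }.

Inductive term (S : signature) (X : Type) : Type :=
| Var (x : X)
| App (f : sym S) (ts : 'I_(arity f) -> term S X).
Arguments Var {S X} x.
Arguments App {S X} f ts.

Fixpoint subst (S : signature) (X Y : Type) (t : term S X)
    (w : X -> term S Y) : term S Y :=
  match t with
  | Var x => w x
  | App f ts => App f (fun i => subst (ts i) w)
  end.

(* For t : term S 'I_n, [eval A t] is the n-ary term operation t^A. *)
Fixpoint eval (S : signature) (A : algebra S) (X : Type) (t : term S X)
    (e : X -> A) : A :=
  match t with
  | Var x => e x
  | App f ts => op (fun i => eval (ts i) e)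
  end.
Arguments eval {S} A {X} t e.

Definition satisfies (S : signature) (A : algebra S) (X : Type)
    (s t : term S X) : Prop :=
  forall e : X -> A, eval A s e = eval A t e.

Definition is_variety (S : signature) (V : algebra S -> Prop) : Prop :=
  exists E : term S nat -> term S nat -> Prop,
    forall A, V A <-> (forall s t, E s t -> satisfies A s t).

Definition models (S : signature) (V : algebra S -> Prop) (X : Type)
    (s t : term S X) : Prop :=
  forall A, V A -> satisfies A s t.

Record congruence (S : signature) (A : algebra S) := Congruence {
  crel :> A -> A -> Prop;
  crefl : forall a, crel a a;
  csym : forall a b, crel a b -> crel b a;
  ctrans : forall a b c, crel a b -> crel b c -> crel a c;
  cop : forall (f : sym S) (a b : 'I_(arity f) -> A),
    (forall i, crel (a i) (b i)) -> crel (op a) (op b) }.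

Lemma con_ext (S : signature) (A : algebra S) (x y : congruence A) :
  (forall a b, x a b <-> y a b) -> x = y.
Proof.
case: x y => [r r1 r2 r3 r4] [s s1 s2 s3 s4] /= rs.
have e : r = s by apply/funext => a; apply/funext => b; apply/propext/rs.
by subst s; congr Congruence; exact: Prop_irrelevance.
Qed.

Definition con_le (S : signature) (A : algebra S) (x y : congruence A) : Prop :=
  forall a b, x a b -> y a b.

#[local] Obligation Tactic := idtac.

Program Definition con_zero (S : signature) (A : algebra S) : congruence A :=
  @Congruence S A (fun a b => a = b) _ _ _ _.
Next Obligation. by []. Qed.
Next Obligation. by []. Qed.
Next Obligation. by move=> S A a b c -> ->. Qed.
Next Obligation. by move=> S A f a b /funext ->. Qed.

Program Definition con_inf (S : signature) (A : algebra S)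
    (P : congruence A -> Prop) : congruence A :=
  @Congruence S A (fun a b => forall d, P d -> d a b) _ _ _ _.
Next Obligation. by move=> S A P a d _; exact: crefl. Qed.
Next Obligation. by move=> S A P a b h d /h; exact: csym. Qed.
Next Obligation.
by move=> S A P a b c hab hbc d Pd; exact: ctrans (hab d Pd) (hbc d Pd).
Qed.
Next Obligation. by move=> S A P f a b h d Pd; apply: cop => i; exact: h. Qed.

Program Definition con_meet (S : signature) (A : algebra S)
    (x y : congruence A) : congruence A :=
  @Congruence S A (fun a b => x a b /\ y a b) _ _ _ _.
Next Obligation. by move=> S A x y a; split; exact: crefl. Qed.
Next Obligation. by move=> S A x y a b [? ?]; split; exact: csym. Qed.
Next Obligation.
by move=> S A x y a b c [xab yab] [xbc ybc]; split;
  [exact: ctrans xab xbc | exact: ctrans yab ybc].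
Qed.
Next Obligation.
by move=> S A x y f a b h; split; apply: cop => i; case: (h i).
Qed.

Definition fcat (T : Type) (m n : nat) (a : 'I_m -> T) (u : 'I_n -> T)
    (i : 'I_(m + n)) : T :=
  match split i with inl j => a j | inr k => u k end.

Definition is_matrix (S : signature) (A : algebra S) (x y : congruence A)
    (p q r s : A) : Prop :=
  exists (m n : nat) (t : term S 'I_(m + n)) (a b : 'I_m -> A)
    (u v : 'I_n -> A),
    [/\ forall i, x (a i) (b i), forall j, y (u j) (v j) &
     [/\ p = eval A t (fcat a u), q = eval A t (fcat a v),
         r = eval A t (fcat b u) & s = eval A t (fcat b v)]].

Definition centralizes (S : signature) (A : algebra S)
    (x y d : congruence A) : Prop :=
  forall p q r s : A, is_matrix x y p q r s -> d p q -> d r s.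

(* [commutator_least] shows that this is the least d with C(x,y;d). *)
Definition commutator (S : signature) (A : algebra S) (x y : congruence A) :
    congruence A :=
  con_inf (centralizes x y).

Lemma commutator_least (S : signature) (A : algebra S) (x y : congruence A) :
  centralizes x y (commutator x y) /\
  (forall d, centralizes x y d -> con_le (commutator x y) d).
Proof.
split=> [p q r s M pq d Cd | d Cd a b]; last exact.
exact: Cd M (pq d Cd).
Qed.

Definition abelian_con (S : signature) (A : algebra S) (x : congruence A) :
    Prop :=
  commutator x x = con_zero A.

Definition is_taylor_term (S : signature) (V : algebra S -> Prop) (n : nat)
    (T : term S 'I_n) : Prop :=
  models V (subst T (fun=> Var 0)) (Var 0) /\
  forall i : 'I_n, exists w z : 'I_n -> nat,
    w i <> z i /\
    models V (subst T (fun j => Var (w j))) (subst T (fun j => Var (z j))).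

Definition has_taylor_term (S : signature) (V : algebra S -> Prop) : Prop :=
  exists (n : nat) (T : term S 'I_n), is_taylor_term V T.

Definition vec3 (T : Type) (a b c : T) : 'I_3 -> T := tnth [tuple a; b; c].

Definition is_difference_term (S : signature) (V : algebra S -> Prop)
    (t : term S 'I_3) : Prop :=
  models V (subst t (vec3 (Var 0) (Var 0) (Var 1))) (Var 1) /\
  forall B, V B -> forall (x : congruence B) (a b : B),
    abelian_con x -> x a b -> eval B t (vec3 a b b) = a.

Definition has_difference_term (S : signature) (V : algebra S -> Prop) : Prop :=
  exists t : term S 'I_3, is_difference_term V t.

Definition weakly_stable_third (S : signature) (V : algebra S -> Prop) : Prop :=
  forall A, V A -> forall x y z z' : congruence A,
    centralizes x y z -> con_le z z' -> con_le z' (con_meet x y) ->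
    centralizes x y z'.

(* Main.v *)
(* (1) => (2). Modulo z the congruence x /\ y is abelian, so the difference term
   t satisfies t(a,b,b) = a on it. Applying t to the rows and columns of a matrix
   shows first that C(x,y;z) implies C(y,x;z), and then that C(x,y;z') holds.

   (2) => (1). Let theta be the congruence of F(x,y) generated by (x,y) and
   eta = [theta,theta]. By (2), theta is abelian modulo every congruence between
   eta and theta. Order F(x,y) by the syntactic preorder of the set of all v for
   which some term E has E(x,x,y) eta y and E(x,y,y) eta v; then x <= y, and y <= x
   would yield a term w with w(x,x,y) eta y and w(x,y,y) eta x. If y <= x failed,
   the class of y would be a proper filter whose syntactic congruence zeta, by the
   Taylor identities, relates x to T(x,..,y,..,x) for every position of y; since
   theta is abelian modulo zeta, replacing the arguments one by one gives
   x zeta y, a contradiction.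

   To make w exact on the left, let alpha = Cg(x,y) and gamma = Cg(x,y,z) in
   F(x,y,z), and let rho be the intersection of alpha with the inverse image of eta
   under (x,y,z) |-> (x,y,y). Then C(gamma,alpha;rho), so by (2) the congruence
   generated by rho and (w(z,z,x), w(z,z,y)) contains
   (w(x,x,x), w(x,x,y)), hence (x,y). This produces a polynomial f(u) = f(x,y,z,u)
   with x rho f(w(z,z,x)) and y rho f(w(z,z,y)), and f(z,z,x,w(x,y,z)) is a
   difference term. *)
From mathcomp Require Import all_boot boolp.
Require Import Defs.

Set Implicit Arguments.
Unset Strict Implicit.
Unset Printing Implicit Defensive.

#[local] Obligation Tactic := idtac.

(** * Terms and the centralizer relation *)

Lemma eval_subst (S : signature) (A : algebra S) (X Y : Type) (t : term S X)
    (w : X -> term S Y) (e : Y -> A) :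
  eval A (subst t w) e = eval A t (fun x => eval A (w x) e).
Proof.
elim: t => [//|f ts IH] /=; congr op; apply/funext => i; exact: IH.
Qed.

Lemma eval_con (S : signature) (A : algebra S) (c : congruence A) (X : Type)
    (t : term S X) (e e' : X -> A) :
  (forall x, c (e x) (e' x)) -> c (eval A t e) (eval A t e').
Proof. by move=> h; elim: t => [x|f ts IH] /=; [exact: h|exact: cop]. Qed.

(** The subalgebra of A^4 generated by the matrices with constant rows or constant columns.
    Induction on it replaces the bookkeeping with two blocks of variables. *)
Inductive mat (S : signature) (A : algebra S) (x y : congruence A) :
    A -> A -> A -> A -> Prop :=
| mat_row p r of x p r : mat x y p p r r
| mat_col p q of y p q : mat x y p q p q
| mat_op (f : sym S) (p q r s : 'I_(arity f) -> A)
    of (forall i, mat x y (p i) (q i) (r i) (s i)) :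
    mat x y (op p) (op q) (op r) (op s).

Lemma mat_cst (S : signature) (A : algebra S) (x y : congruence A) (a : A) :
  mat x y a a a a.
Proof. exact/mat_row/crefl. Qed.

Lemma mat_eval (S : signature) (A : algebra S) (x y : congruence A) (I : Type)
    (t : term S I) (p q r s : I -> A) :
  (forall i, mat x y (p i) (q i) (r i) (s i)) ->
  mat x y (eval A t p) (eval A t q) (eval A t r) (eval A t s).
Proof. by move=> h; elim: t => [i|f ts IH] /=; [exact: h|exact: mat_op]. Qed.

Lemma mat_tr (S : signature) (A : algebra S) (x y : congruence A)
    (p q r s : A) : mat x y p q r s -> mat y x p r q s.
Proof.
by elim=> [? ? ?|? ? ?|f p' q' r' s' _ IH];
  [exact: mat_col|exact: mat_row|exact: mat_op].
Qed.

Lemma mat_rows (S : signature) (A : algebra S) (x y : congruence A)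
    (p q r s : A) : mat x y p q r s -> x p r /\ x q s.
Proof.
elim=> [//|? ? _|f p' q' r' s' _ IH]; first by split; exact: crefl.
by split; apply: cop => i; case: (IH i).
Qed.

Lemma mat_finitary (S : signature) (A : algebra S) (x y : congruence A)
    (p q r s : A) :
  mat x y p q r s ->
  exists (n : nat) (t : term S 'I_n) (P : 'I_n -> A * A * A * A),
    (forall i, let: (a, b, c, d) := P i in
      [/\ a = b, c = d & x a c] \/ [/\ a = c, b = d & y a b]) /\
    [/\ p = eval A t (fun i => (P i).1.1.1), q = eval A t (fun i => (P i).1.1.2),
        r = eval A t (fun i => (P i).1.2) & s = eval A t (fun i => (P i).2)].
Proof.
elim=> [a c xac|a b yab|f p' q' r' s' _ IH].
- exists 1, (Var ord0), (fun=> (a, a, c, c)).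
  by split => // i; left.
- exists 1, (Var ord0), (fun=> (a, b, a, b)).
  by split => // i; right.
pose K := {n : nat & (term S 'I_n * ('I_n -> A * A * A * A))%type}.
have /choice[g gP] : forall i, exists k : K,
    (forall j, let: (a, b, c, d) := (projT2 k).2 j in
      [/\ a = b, c = d & x a c] \/ [/\ a = c, b = d & y a b]) /\
    [/\ p' i = eval A (projT2 k).1 (fun j => ((projT2 k).2 j).1.1.1),
        q' i = eval A (projT2 k).1 (fun j => ((projT2 k).2 j).1.1.2),
        r' i = eval A (projT2 k).1 (fun j => ((projT2 k).2 j).1.2) &
        s' i = eval A (projT2 k).1 (fun j => ((projT2 k).2 j).2)].
  by move=> i; have [n [t [P h]]] := IH i; exists (existT _ n (t, P)).
(* The generators used by all arguments are renumbered along one disjoint union. *)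
pose D : finType := {i : 'I_(arity f) & 'I_(projT1 (g i))}.
pose P (k : 'I_#|D|) := let u : D := enum_val k in (projT2 (g (tag u))).2 (tagged u).
exists #|D|, (App f (fun i => subst (projT2 (g i)).1
  (fun j => Var (enum_rank (Tagged (fun i => 'I_(projT1 (g i))) j : D))))), P.
split; first by move=> k; exact: (gP _).1.
by split=> /=; congr op; apply/funext => i; rewrite eval_subst /P;
  case: (gP i) => _ [h1 h2 h3 h4]; rewrite ?h1 ?h2 ?h3 ?h4; congr eval;
  apply/funext => j /=; rewrite enum_rankK.
Qed.

Lemma fcat_lshift (T : Type) (m n : nat) (a : 'I_m -> T) (u : 'I_n -> T) i :
  fcat a u (lshift n i) = a i.
Proof. by rewrite /fcat (unsplitK (inl i)). Qed.

Lemma fcat_rshift (T : Type) (m n : nat) (a : 'I_m -> T) (u : 'I_n -> T) i :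
  fcat a u (rshift m i) = u i.
Proof. by rewrite /fcat (unsplitK (inr i)). Qed.

Lemma mat_is_matrix (S : signature) (A : algebra S) (x y : congruence A)
    (p q r s : A) : mat x y p q r s <-> is_matrix x y p q r s.
Proof.
split=> [/mat_finitary[n [t [P [hP [-> -> -> ->]]]]]|]; last first.
  move=> [m [n [t [a [b [u [v [xab yuv [-> -> -> ->]]]]]]]]].
  apply: mat_eval => i; rewrite /fcat; case: (split i) => j.
    exact: mat_row.
  exact: mat_col.
pose X i := [/\ (P i).1.1.1 = (P i).1.1.2, (P i).1.2 = (P i).2 &
               x (P i).1.1.1 (P i).1.2].
have nX i : ~ X i -> [/\ (P i).1.1.1 = (P i).1.2, (P i).1.1.2 = (P i).2 &
                      y (P i).1.1.1 (P i).1.1.2].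
  by move: (hP i); rewrite /X; case: (P i) => [[[? ?] ?] ?] [].
(* Both blocks get n variables: generator i is read from the left block if its rows are constant and
   from the right block otherwise; the idle position holds a pair of equal elements. *)
exists n, n, (subst t (fun i => Var (if `[< X i >] then lshift n i
                                    else rshift n i))).
exists (fun i => (P i).1.1.1),
  (fun i => if `[< X i >] then (P i).1.2 else (P i).1.1.1),
  (fun i => (P i).1.1.1),
  (fun i => if `[< X i >] then (P i).1.1.1 else (P i).1.1.2).
split.
- by move=> i; case: asboolP => [[]//|_]; exact: crefl.
- by move=> i; case: asboolP => [_|/nX[]//]; exact: crefl.
split; rewrite eval_subst; congr eval; apply/funext => i /=;
  case: (asboolP (X i)) => Xi; rewrite ?fcat_lshift ?fcat_rshift //;
  case: (asboolP (X i)) => // _.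
- by case: Xi.
- by case: (nX i Xi).
- by case: Xi.
- by case: (nX i Xi).
Qed.

Lemma centralizesP (S : signature) (A : algebra S) (x y d : congruence A) :
  centralizes x y d <->
  (forall p q r s, mat x y p q r s -> d p q -> d r s).
Proof.
by split=> C p q r s /mat_is_matrix M; exact: C M.
Qed.

Lemma mat_le (S : signature) (A : algebra S) (x x' y y' : congruence A)
    (p q r s : A) :
  con_le x' x -> con_le y' y -> mat x' y' p q r s -> mat x y p q r s.
Proof.
move=> lx ly; elim=> [? ? /lx|? ? /ly|f p' q' r' s' _ IH].
- exact: mat_row.
- exact: mat_col.
- exact: mat_op.
Qed.

Lemma centralizes_anti (S : signature) (A : algebra S)
    (x x' y y' d : congruence A) :
  con_le x' x -> con_le y' y -> centralizes x y d -> centralizes x' y' d.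
Proof.
move=> lx ly /centralizesP C; apply/centralizesP => p q r s M.
exact/C/(mat_le lx ly M).
Qed.

Lemma centralizes_self (S : signature) (A : algebra S) (x y : congruence A) :
  centralizes x y y.
Proof. by apply/centralizesP => p q r s /mat_tr/mat_rows[]. Qed.

Lemma centralizes_meet (S : signature) (A : algebra S)
    (x y d d' : congruence A) :
  centralizes x y d -> centralizes x y d' -> centralizes x y (con_meet d d').
Proof.
by move=> C C' p q r s M [/(C _ _ _ _ M) ? /(C' _ _ _ _ M) ?].
Qed.

Lemma abelian_conP (S : signature) (A : algebra S) (x : congruence A) :
  abelian_con x <-> centralizes x x (con_zero A).
Proof.
have [C L] := commutator_least x x.
split=> [<- //|C0]; apply: con_ext => a b; split=> [|->]; first exact: L.
exact: crefl.
Qed.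

(** * Inverse images and quotients *)

Definition hom (S : signature) (A B : algebra S) (g : A -> B) : Prop :=
  forall (f : sym S) (a : 'I_(arity f) -> A), g (op a) = op (fun i => g (a i)).

Program Definition preimage_con (S : signature) (A B : algebra S) (g : A -> B)
    (hg : hom g) (c : congruence B) : congruence A :=
  @Congruence S A (fun a b => c (g a) (g b)) _ _ _ _.
Next Obligation. by move=> *; exact: crefl. Qed.
Next Obligation. by move=> *; exact: csym. Qed.
Next Obligation. by move=> S A B g hg c a b d; exact: ctrans. Qed.
Next Obligation. by move=> S A B g hg c f a b h; rewrite /= !hg; exact: cop. Qed.

Lemma mat_hom (S : signature) (A B : algebra S) (g : A -> B) (hg : hom g)
    (x y : congruence A) (x' y' : congruence B) (p q r s : A) :
  (forall a b, x a b -> x' (g a) (g b)) ->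
  (forall a b, y a b -> y' (g a) (g b)) ->
  mat x y p q r s -> mat x' y' (g p) (g q) (g r) (g s).
Proof.
move=> lx ly; elim=> [? ? /lx|? ? /ly|f p' q' r' s' _ IH].
- exact: mat_row.
- exact: mat_col.
- by rewrite !hg; exact: mat_op.
Qed.

Lemma centralizes_preimage (S : signature) (A B : algebra S) (g : A -> B)
    (hg : hom g) (x y d : congruence B) :
  centralizes x y d ->
  centralizes (preimage_con hg x) (preimage_con hg y) (preimage_con hg d).
Proof.
move=> /centralizesP C; apply/centralizesP => p q r s M.
by apply: C; exact: mat_hom M.
Qed.

Section Quotient.
Variables (S : signature) (A : algebra S) (k : congruence A).

(** Classes are predicates, so that related elements have equal classes by extensionality. *)
Definition coset : Type := {Q : A -> Prop | exists a, Q = k a}.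

Definition cls (a : A) : coset := exist _ (crel k a) (ex_intro _ a erefl).

Definition crepr (Q : coset) : A := projT1 (cid (proj2_sig Q)).

Lemma cls_eq (a b : A) : k a b -> cls a = cls b.
Proof.
move=> kab; apply: eq_exist; apply/funext => c; apply/propext.
by split; apply: ctrans => //; exact: csym.
Qed.

Lemma crepr_cls (a : A) : k (crepr (cls a)) a.
Proof.
rewrite /crepr; case: cid => b /= e.
by rewrite -e; exact: crefl.
Qed.

Lemma cls_crepr (Q : coset) : cls (crepr Q) = Q.
Proof.
by case: Q => Q hQ; apply: eq_exist; rewrite /crepr; case: cid.
Qed.

Definition quotient : algebra S :=
  @Algebra S coset (fun f Q => cls (op (fun i => crepr (Q i)))).

Lemma cls_hom : @hom S A quotient cls.
Proof.
by move=> f a; apply: cls_eq; apply: cop => i; exact/csym/crepr_cls.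
Qed.

Lemma eval_cls (X : Type) (t : term S X) (e : X -> A) :
  eval quotient t (fun i => cls (e i)) = cls (eval A t e).
Proof.
elim: t => [//|f ts IH] /=; apply: cls_eq; apply: cop => i.
by rewrite IH; exact: crepr_cls.
Qed.

Lemma quotient_satisfies (X : Type) (s t : term S X) :
  (forall e : X -> A, k (eval A s e) (eval A t e)) -> satisfies quotient s t.
Proof.
move=> h e; have -> : e = (fun i => cls (crepr (e i))).
  by apply/funext => i; rewrite cls_crepr.
by rewrite !eval_cls; exact: cls_eq.
Qed.

Program Definition image_con (c : congruence A) (kc : con_le k c) :
    congruence quotient :=
  @Congruence S quotient (fun P Q => c (crepr P) (crepr Q)) _ _ _ _.
Next Obligation. by move=> *; exact: crefl. Qed.
Next Obligation. by move=> *; exact: csym. Qed.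
Next Obligation. by move=> c kc P Q R; exact: ctrans. Qed.
Next Obligation.
move=> c kc f P Q h.
apply: ctrans (kc _ _ (crepr_cls _)) _.
apply: ctrans (csym (kc _ _ (crepr_cls _))).
exact: cop.
Qed.

Lemma image_conE (c : congruence A) (kc : con_le k c) (a b : A) :
  image_con kc (cls a) (cls b) <-> c a b.
Proof.
rewrite /image_con /=; split=> h.
- apply: ctrans (csym (kc _ _ (crepr_cls _))) _.
  exact: ctrans h (kc _ _ (crepr_cls _)).
- apply: ctrans (kc _ _ (crepr_cls _)) _.
  exact: ctrans h (csym (kc _ _ (crepr_cls _))).
Qed.

Lemma centralizes_image (x y d : congruence A) (kx : con_le k x)
    (ky : con_le k y) (kd : con_le k d) :
  centralizes x y d <->
  centralizes (image_con kx) (image_con ky) (image_con kd).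
Proof.
split=> /centralizesP C; apply/centralizesP => p q r s M; last first.
  move=> /(image_conE kd) dpq; apply/(image_conE kd); apply: C dpq.
  by apply: (mat_hom cls_hom) M => a b ?; apply/image_conE.
(* Every matrix of the quotient lifts to A: generators by representatives, operations argument by
   argument. *)
have [p' [q' [r' [s' [-> -> -> -> M']]]]] : exists p' q' r' s',
    [/\ p = cls p', q = cls q', r = cls r', s = cls s' & mat x y p' q' r' s'].
  elim: M => {p q r s} [p r xpr|p q ypq|f p q r s _ IH].
  - exists (crepr p), (crepr p), (crepr r), (crepr r).
    by rewrite !cls_crepr; split => //; exact: mat_row.
  - exists (crepr p), (crepr q), (crepr p), (crepr q).
    by rewrite !cls_crepr; split => //; exact: mat_col.
  have /choice[g gP] : forall i, exists P : A * A * A * A,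
      [/\ p i = cls P.1.1.1, q i = cls P.1.1.2, r i = cls P.1.2,
          s i = cls P.2 & mat x y P.1.1.1 P.1.1.2 P.1.2 P.2].
    by move=> i; have [p' [q' [r' [s' h]]]] := IH i; exists (p', q', r', s').
  exists (op (fun i => (g i).1.1.1)), (op (fun i => (g i).1.1.2)),
    (op (fun i => (g i).1.2)), (op (fun i => (g i).2)).
  split; last by apply: mat_op => i; case: (gP i).
  - by rewrite cls_hom; congr op; apply/funext => i; case: (gP i).
  - by rewrite cls_hom; congr op; apply/funext => i; case: (gP i).
  - by rewrite cls_hom; congr op; apply/funext => i; case: (gP i).
  - by rewrite cls_hom; congr op; apply/funext => i; case: (gP i).
by move=> /image_conE dpq; apply/image_conE; exact: C M' dpq.
Qed.

End Quotient.

Lemma variety_quotient (S : signature) (V : algebra S -> Prop) (A : algebra S)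
    (k : congruence A) :
  is_variety V ->
  (forall s t : term S nat, models V s t ->
    forall e : nat -> A, k (eval A s e) (eval A t e)) ->
  V (quotient k).
Proof.
move=> [E VE] h; apply/VE => s t Est; apply: quotient_satisfies; apply: h.
by move=> B /VE /(_ _ _ Est).
Qed.

(** Congruences above k correspond to those of A/k. With k the equational theory of V, this makes
    weak stability available in term algebras. *)
Lemma weakly_stable_above (S : signature) (V : algebra S -> Prop)
    (A : algebra S) (k x y z z' : congruence A) :
  weakly_stable_third V -> V (quotient k) -> con_le k z ->
  centralizes x y z -> con_le z z' -> con_le z' (con_meet x y) ->
  centralizes x y z'.
Proof.
move=> W Vk kz C zz' z'xy.
have kz' : con_le k z' by move=> a b /kz /zz'.
have kx : con_le k x by move=> a b /kz' /z'xy[].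
have ky : con_le k y by move=> a b /kz' /z'xy[].
apply/(centralizes_image kx ky kz').
apply: (W _ Vk _ _ (image_con kz)).
- exact/(centralizes_image kx ky kz).
- by move=> P Q /zz'.
- by move=> P Q /z'xy.
Qed.

(** * Ternary terms *)

Lemma hom_eval (S : signature) (A B : algebra S) (g : A -> B) (X : Type)
    (t : term S X) (e : X -> A) :
  hom g -> g (eval A t e) = eval B t (fun x => g (e x)).
Proof.
move=> hg; elim: t => [//|f ts IH] /=.
by rewrite hg; congr op; apply/funext => i.
Qed.

Lemma vec3_comp (T U : Type) (g : T -> U) (a b c : T) :
  (fun i => g (vec3 a b c i)) = vec3 (g a) (g b) (g c).
Proof. by apply/funext => -[[|[|[|//]]] h]. Qed.

Definition app3 (S : signature) (A : algebra S) (t : term S 'I_3) (a b c : A) :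
    A := eval A t (vec3 a b c).
Arguments app3 {S} A t a b c.

Lemma app3_hom (S : signature) (A B : algebra S) (g : A -> B)
    (t : term S 'I_3) (a b c : A) :
  hom g -> g (app3 A t a b c) = app3 B t (g a) (g b) (g c).
Proof. by move=> hg; rewrite /app3 hom_eval // vec3_comp. Qed.

Lemma app3_con (S : signature) (A : algebra S) (d : congruence A)
    (t : term S 'I_3) (a b c a' b' c' : A) :
  d a a' -> d b b' -> d c c' -> d (app3 A t a b c) (app3 A t a' b' c').
Proof. by move=> *; apply: eval_con => -[[|[|[|//]]] h]. Qed.

Lemma app3_mat (S : signature) (A : algebra S) (x y : congruence A)
    (t : term S 'I_3) (a b c d a' b' c' d' a'' b'' c'' d'' : A) :
  mat x y a b c d -> mat x y a' b' c' d' -> mat x y a'' b'' c'' d'' ->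
  mat x y (app3 A t a a' a'') (app3 A t b b' b'') (app3 A t c c' c'')
    (app3 A t d d' d'').
Proof. by move=> *; apply: mat_eval => -[[|[|[|//]]] h]. Qed.

Lemma eval_subst_vec3 (S : signature) (A : algebra S) (X : Type)
    (t : term S 'I_3) (a b c : term S X) (e : X -> A) :
  eval A (subst t (vec3 a b c)) e =
  app3 A t (eval A a e) (eval A b e) (eval A c e).
Proof. by rewrite eval_subst (vec3_comp (fun s => eval A s e)). Qed.

(** * From a difference term to weak stability *)

(** Passing to A/z turns w into an abelian congruence. *)
Lemma difference_term_mod (S : signature) (V : algebra S -> Prop)
    (t : term S 'I_3) (A : algebra S) (w z : congruence A) (a b : A) :
  is_variety V -> is_difference_term V t -> V A ->
  centralizes w w z -> con_le z w -> w a b -> z (app3 A t a b b) a.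
Proof.
move=> hV [_ tE] VA C zw wab.
have zz : con_le z z by [].
have Vz : V (quotient z).
  apply: variety_quotient hV _ => s s' h e.
  by rewrite (h A VA); exact: crefl.
have ab : abelian_con (image_con zw).
  apply/abelian_conP; have <- : image_con zz = con_zero _.
    apply: con_ext => P Q; split=> /= [h|->]; last exact: crefl.
    by rewrite -(cls_crepr P) -(cls_crepr Q); exact: cls_eq.
  exact/(centralizes_image zw zw zz).
have /(tE _ Vz _ _ _ ab) e : image_con zw (cls z a) (cls z b).
  exact/image_conE.
apply/(image_conE zz).
rewrite (app3_hom _ _ _ _ (cls_hom z)) /app3 e.
exact: crefl.
Qed.

Lemma difference_term_idl (S : signature) (V : algebra S -> Prop)
    (t : term S 'I_3) (A : algebra S) (a b : A) :
  is_difference_term V t -> V A -> app3 A t a a b = b.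
Proof.
move=> [tE _] VA.
by have := tE A VA (fun n => if n is 0 then a else b); rewrite eval_subst_vec3.
Qed.

Lemma difference_term_stable (S : signature) (V : algebra S -> Prop) :
  is_variety V -> has_difference_term V -> weakly_stable_third V.
Proof.
move=> hV [t ht] A VA x y z z' C zz' z'xy.
have zxy : con_le z (con_meet x y) by move=> a b /zz' /z'xy.
have tl a b : app3 A t a a b = b by exact: difference_term_idl ht VA.
have Cxy : centralizes (con_meet x y) (con_meet x y) z.
  by apply: centralizes_anti C => a b [].
have tr a b : x a b -> y a b -> z (app3 A t a b b) a.
  by move=> xab yab; apply: difference_term_mod hV ht VA Cxy zxy _.
have /centralizesP C' := C.
have Cyx : forall p q r s, mat y x p q r s -> z p q -> z r s.
  move=> p q r s M zpq.
  have [ypr yqs] := mat_rows M; have [xpq xrs] := mat_rows (mat_tr M).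
  (* The matrix has first row t(p,p,r) = r, t(r,r,r) = r and second row t(q,p,r), t(s,r,r). Its last
     entry is s modulo z, since x and y both relate s to r. *)
  have := C' _ _ _ _ (app3_mat t (mat_tr M) (mat_col x ypr) (mat_cst x y r)).
  rewrite !tl => /(_ (crefl z r)) h.
  have h1 : z r (app3 A t q p r).
    rewrite -{1}(tl p r); apply: app3_con => //; exact: crefl.
  apply: ctrans h1 (ctrans h _); apply: tr; first exact: csym.
  apply: ctrans (csym yqs) (ctrans _ ypr).
  by case: (zxy _ _ zpq) => _; exact: csym.
apply/centralizesP => p q r s M z'pq.
have [xpr xqs] := mat_rows M; have [ypq yrs] := mat_rows (mat_tr M).
(* The same matrix with x and y exchanged; this time r and t(q,p,r) are related through z'. *)
have := Cyx _ _ _ _ (app3_mat t (mat_tr M) (mat_col y xpr) (mat_cst y x r)).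
rewrite !tl => /(_ (crefl z r)) h.
have h1 : z' r (app3 A t q p r).
  rewrite -{1}(tl p r); apply: app3_con => //; exact: crefl.
apply: ctrans h1 (zz' _ _ (ctrans h _)); apply: tr; last exact: csym.
apply: ctrans (csym xqs) (ctrans _ xpr).
by case: (z'xy _ _ z'pq) => ? _; exact: csym.
Qed.

(** * Syntactic preorders *)

Section Syntactic.
Variables (S : signature) (A : algebra S).

Definition pol (f : term S (option A)) (a : A) : A := eval A f (oapp id a).

Lemma pol_con (d : congruence A) (f : term S (option A)) (a b : A) :
  d a b -> d (pol f a) (pol f b).
Proof. by move=> dab; apply: eval_con => -[c|//]; exact: crefl. Qed.

Lemma pol_comp (f g : term S (option A)) (a : A) :
  pol f (pol g a) = pol (subst f (oapp (fun c => Var (Some c)) g)) a.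
Proof.
rewrite /pol eval_subst; congr eval; apply/funext => -[c|] //=.
Qed.

(** The largest compatible preorder for which P is upward closed. *)
Definition syn (P : A -> Prop) (a b : A) : Prop :=
  forall f, P (pol f a) -> P (pol f b).

Variable P : A -> Prop.

Lemma syn_refl (a : A) : syn P a a.
Proof. by []. Qed.

Lemma syn_trans (a b c : A) : syn P a b -> syn P b c -> syn P a c.
Proof. by move=> ab bc f /ab /bc. Qed.

Lemma syn_pol (g : term S (option A)) (a b : A) :
  syn P a b -> syn P (pol g a) (pol g b).
Proof. by move=> ab f; rewrite !pol_comp; exact: ab. Qed.

Lemma syn_op (f : sym S) (a b : 'I_(arity f) -> A) :
  (forall i, syn P (a i) (b i)) -> syn P (op a) (op b).
Proof.
(* Arguments are exchanged one at a time, each exchange taking place inside a unary polynomial. *)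
move=> ab; pose mix k (i : 'I_(arity f)) := if i < k then b i else a i.
suff h k : k <= arity f -> syn P (op a) (op (mix k)).
  have := h _ (leqnn _); congr (syn _ _ (op _)).
  by apply/funext => i; rewrite /mix ltn_ord.
elim: k => [_|k IH lt_k].
  by rewrite (_ : mix 0 = a) //; exact: syn_refl.
apply: syn_trans (IH (ltnW lt_k)) _.
pose g : term S (option A) := App f
  (fun i => Var (if i == Ordinal lt_k then None else Some (mix k i))).
have -> : op (mix k) = pol g (a (Ordinal lt_k)).
  congr op; apply/funext => i /=; case: eqP => [->|//] /=.
  by rewrite /mix ltnn.
have -> : op (mix k.+1) = pol g (b (Ordinal lt_k)).
  congr op; apply/funext => i /=; case: eqP => [->|ne] /=.
    by rewrite /mix /= ltnSn.
  rewrite /mix ltnS leq_eqVlt; case: eqP => // e.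
  by case: ne; apply/val_inj.
exact/syn_pol/ab.
Qed.

Lemma syn_eval (X : Type) (t : term S X) (e e' : X -> A) :
  (forall i, syn P (e i) (e' i)) -> syn P (eval A t e) (eval A t e').
Proof. by move=> h; elim: t => [i|f ts IH] /=; [exact: h|exact: syn_op]. Qed.

(** The largest congruence for which P is a union of classes. *)
Program Definition con_syn : congruence A :=
  @Congruence S A (fun a b => syn P a b /\ syn P b a) _ _ _ _.
Next Obligation. by move=> a; split; exact: syn_refl. Qed.
Next Obligation. by move=> a b []. Qed.
Next Obligation.
by move=> a b c [ab ba] [bc cb]; split; [exact: syn_trans bc|
  exact: syn_trans ba].
Qed.
Next Obligation. by move=> f a b h; split; apply: syn_op => i; case: (h i). Qed.

Lemma le_con_syn (d : congruence A) :
  (forall a b, d a b -> P a -> P b) -> con_le d con_syn.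
Proof.
move=> h a b dab; split=> f; apply: h; apply: pol_con => //.
exact: csym.
Qed.

End Syntactic.

(** * Free algebras *)

Definition term_algebra (S : signature) (X : Type) : algebra S :=
  @Algebra S (term S X) (@App S X).

Lemma eval_Var (S : signature) (X : Type) (t : term S X) :
  eval (term_algebra S X) t Var = t.
Proof. by elim: t => [//|f ts IH] /=; congr App; apply/funext. Qed.

Lemma eval_hom (S : signature) (X : Type) (B : algebra S) (e : X -> B) :
  @hom S (term_algebra S X) B (fun t => eval B t e).
Proof. by []. Qed.

Lemma eval_app3 (S : signature) (X : Type) (B : algebra S) (e : X -> B)
    (t : term S 'I_3) (a b c : term_algebra S X) :
  eval B (app3 (term_algebra S X) t a b c) e =
  app3 B t (eval B a e) (eval B b e) (eval B c e).
Proof. exact: (app3_hom _ _ _ _ (eval_hom e)). Qed.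

Lemma eval_eval (S : signature) (X Y : Type) (B : algebra S) (e : X -> B)
    (t : term S Y) (w : Y -> term_algebra S X) :
  eval B (eval (term_algebra S X) t w) e = eval B t (fun y => eval B (w y) e).
Proof. exact: (hom_eval _ _ (eval_hom e)). Qed.

(* [None] is the variable of the polynomial, [Some i] the generator [i]. *)
Definition flat (S : signature) (X : Type)
    (f : term S (option (term_algebra S X))) : term S (option X) :=
  eval (term_algebra S (option X)) f
    (oapp (fun c : term_algebra S X =>
       eval (term_algebra S (option X)) c (fun i => Var (Some i))) (Var None)).

Lemma eval_flat (S : signature) (X : Type) (B : algebra S)
    (f : term S (option (term_algebra S X))) (e : X -> B)
    (v : term_algebra S X) :
  eval B (pol f v) e = eval B (flat f) (oapp e (eval B v e)).
Proof.
rewrite /flat /pol !eval_eval; congr eval; apply/funext => -[c|//] /=.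
by rewrite eval_eval.
Qed.

Lemma pol_flat (S : signature) (X : Type)
    (f : term S (option (term_algebra S X))) (v : term_algebra S X) :
  pol f v = eval (term_algebra S X) (flat f) (oapp Var v).
Proof. by rewrite -{2}(eval_Var v) -eval_flat eval_Var. Qed.

Definition pair (T : Type) (a b : T) (i : bool) : T := if i then b else a.

(** * The commutator in the free algebra on two generators *)

Section Free.
Variables (S : signature) (V : algebra S -> Prop).
Hypothesis hV : is_variety V.

(** The free algebra on X is the quotient by this congruence; computing with terms modulo it avoids
    choosing representatives. *)
Program Definition eqV (X : Type) : congruence (term_algebra S X) :=
  @Congruence S (term_algebra S X) (fun s t => models V s t) _ _ _ _.
Next Obligation. by []. Qed.
Next Obligation. by move=> X s t h A VA e; rewrite (h A VA e). Qed.
Next Obligation.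
by move=> X s t u h h' A VA e; rewrite (h A VA e) (h' A VA e).
Qed.
Next Obligation.
move=> X f s t h A VA e /=; congr op; apply/funext => i; exact: h.
Qed.

Lemma eqV_eval (X Y : Type) (s t : term S X) (e : X -> term_algebra S Y) :
  models V s t ->
  eqV Y (eval (term_algebra S Y) s e) (eval (term_algebra S Y) t e).
Proof. by move=> h A VA g; rewrite !eval_eval h. Qed.

Lemma free_in_variety (X : Type) : V (quotient (eqV X)).
Proof. by apply: variety_quotient hV _ => s t h e; exact: eqV_eval. Qed.

Notation F2 := (term_algebra S bool).
Notation x := (Var false : F2).
Notation y := (Var true : F2).

(** The congruence theta generated by (x,y), lifted to terms: the kernel of the retraction that
    sends both generators to y. *)
Definition collapse : congruence F2 :=
  preimage_con (@eval_hom S bool F2 (fun=> y)) (eqV bool).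

(** The commutator [theta,theta] of the free algebra, lifted to terms. *)
Definition eta : congruence F2 :=
  con_inf (fun d => con_le (eqV bool) d /\ centralizes collapse collapse d).

Lemma eqV_collapse : con_le (eqV bool) collapse.
Proof. by move=> s t h; exact: eqV_eval. Qed.

Lemma collapse_xy : collapse x y.
Proof. exact: crefl. Qed.

Lemma eqV_eta : con_le (eqV bool) eta.
Proof. by move=> s t h d [+ _]; exact. Qed.

Lemma eta_collapse : con_le eta collapse.
Proof.
move=> s t; apply; split; [exact: eqV_collapse|exact: centralizes_self].
Qed.

Lemma centralizes_eta : centralizes collapse collapse eta.
Proof.
move=> p q r s M h d [Vd Cd].
exact: Cd M (h d (conj Vd Cd)).
Qed.

(** The preimage of d is one of the congruences intersected in [eta]. Indeed the preimage of a
    contains [collapse], because replacing x by y moves the value of a term only within its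
    a-class. *)
Lemma eta_eval (B : algebra S) (a d : congruence B) (e : bool -> B)
    (s t : F2) :
  (forall s t : term S bool, models V s t -> d (eval B s e) (eval B t e)) ->
  con_le d a -> centralizes a a d -> a (e false) (e true) ->
  eta s t -> d (eval B s e) (eval B t e).
Proof.
move=> Vd da Cd axy.
apply: (_ : eta s t -> preimage_con (eval_hom e) d s t); apply; split=> //.
suff le : con_le collapse (preimage_con (eval_hom e) a).
  exact/(centralizes_anti le le)/centralizes_preimage.
move=> {}s {}t /= /Vd h.
have cst u : a (eval B u e) (eval B (eval F2 u (fun=> y)) e).
  by rewrite eval_eval; apply: eval_con => -[] //=; exact: crefl.
apply: ctrans (cst s) (ctrans (da _ _ h) _); exact/csym/cst.
Qed.

Lemma eta_subst (u v s t : F2) : collapse u v -> eta s t ->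
  eta (eval F2 s (pair u v)) (eval F2 t (pair u v)).
Proof.
move=> uv; apply: (@eta_eval F2 collapse eta) => //.
- by move=> {}s {}t h; exact/eqV_eta/eqV_eval.
- exact: eta_collapse.
- exact: centralizes_eta.
Qed.

Notation "t ⟨ a , b , c ⟩" := (app3 F2 t a b c)
  (at level 2, a at level 200, b at level 200, c at level 200,
   format "t ⟨ a ,  b ,  c ⟩").
Notation "a ~ b" := (collapse a b) (at level 70).
Notation "a ≡ b" := (eta a b) (at level 70).

Lemma eta_app3 (E : term S 'I_3) :
  E⟨x, x, y⟩ ≡ y -> forall u v, u ~ v -> E⟨u, u, v⟩ ≡ v.
Proof. by move=> h u v uv; have := eta_subst uv h; rewrite eval_app3. Qed.

Definition reach (v : F2) : Prop :=
  exists E : term S 'I_3, E⟨x, x, y⟩ ≡ y /\ E⟨x, y, y⟩ ≡ v.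

(* In an affine algebra E(x,x,y) = y means E = z + r (x - y). Replacing E by
   E(z,y,t) adds up such coefficients along a chain of terms t. *)
Lemma reach_step (t : term S 'I_3) : reach t⟨x, x, y⟩ -> reach t⟨x, y, y⟩.
Proof.
move=> [E [Ey Ev]]; have El := eta_app3 Ey.
have cxy := collapse_xy.
have cE : E⟨x, y, y⟩ ~ y.
  apply: ctrans (eta_collapse Ey).
  by apply: app3_con; [exact: crefl|exact: csym|exact: crefl].
have ct : t⟨x, y, y⟩ ~ y.
  apply: ctrans (ctrans (csym (eta_collapse Ev)) cE).
  by apply: app3_con; [exact: crefl|exact: csym|exact: crefl].
pose E' := subst E (vec3 (Var (@Ordinal 3 2 isT)) (Var (@Ordinal 3 1 isT)) t).
have E'E a b c : E'⟨a, b, c⟩ = E⟨c, b, t⟨a, b, c⟩⟩.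
  by rewrite /E' [LHS]/app3 eval_subst_vec3.
exists E'; rewrite !E'E; split; last exact/El/csym.
apply: (@ctrans _ _ _ _ E⟨y, x, E⟨x, y, y⟩⟩).
  by apply: app3_con; [exact: crefl|exact: crefl|exact: csym].
(* Both entries of the first row are E(x,y,y) modulo [eta], so the second row is related too, and
   its last entry is y modulo [eta]. *)
have M : mat collapse collapse
    E⟨x, x, E⟨x, y, y⟩⟩ E⟨x, y, E⟨y, y, y⟩⟩
    E⟨y, x, E⟨x, y, y⟩⟩ E⟨y, y, E⟨y, y, y⟩⟩.
  apply: app3_mat; [exact: mat_row|exact: mat_col|].
  by apply: app3_mat; [exact: mat_col|exact: mat_cst|exact: mat_cst].
have Eyy := El y y (crefl _ _).
have /centralizesP C := centralizes_eta.
have := C _ _ _ _ M; move/(_ _)/ctrans; apply.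
  apply: ctrans (El _ _ _) (app3_con _ _ _ (csym Eyy)); [|exact: crefl..].
  exact: ctrans (csym cE).
exact: ctrans (El _ _ (csym (eta_collapse Eyy))) Eyy.
Qed.

Lemma reach_y : reach y.
Proof. by exists (Var (@Ordinal 3 2 isT)); split; exact: crefl. Qed.

Lemma reach_eta (u v : F2) : u ≡ v -> reach u -> reach v.
Proof. by move=> uv [E [Ey Eu]]; exists E; split=> //; exact: ctrans uv. Qed.

(** The constants of a polynomial on F(x,y) are terms in x and y, so the polynomial has the form
    t(x,v,y) and [reach_step] applies. *)
Lemma syn_reach_xy : syn reach x y.
Proof.
move=> f; pose t : term S 'I_3 := subst (flat f) (fun o =>
  Var (match o with None => @Ordinal 3 1 isT | Some false => @Ordinal 3 0 isT
       | Some true => @Ordinal 3 2 isT end)).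
suff tE v : pol f v = t⟨x, v, y⟩ by rewrite !tE; exact: reach_step.
rewrite pol_flat /t [RHS]/app3 eval_subst; congr eval.
by apply/funext => -[[]|].
Qed.

(** * Using the Taylor identities *)

Section Taylor.
Hypothesis stable : weakly_stable_third V.

Lemma stable_collapse (d : congruence F2) :
  con_le eta d -> con_le d collapse -> centralizes collapse collapse d.
Proof.
move=> ld dc; apply: (weakly_stable_above stable (free_in_variety bool)).
- exact: eqV_eta.
- exact: centralizes_eta.
- exact: ld.
- by move=> a b /dc.
Qed.

Variables (n : nat) (T : term S 'I_n).
Hypothesis taylorT : is_taylor_term V T.

Notation T_ e := (eval F2 T e).

Lemma taylor_idem (u : F2) (e : 'I_n -> F2) :
  (forall i, e i = u) -> eqV bool (T_ e) u.
Proof.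
move=> /funext -> A VA g; rewrite eval_eval.
by have := taylorT.1 A VA (fun=> eval A u g); rewrite eval_subst.
Qed.

(** In the j-th Taylor identity, rename the variable w_j to x and all others to y. *)
Lemma taylor_identity (j : 'I_n) : exists w z : 'I_n -> bool,
  [/\ w j = false, z j = true &
      eqV bool (T_ (fun i => Var (w i))) (T_ (fun i => Var (z i)))].
Proof.
have [w [z [wz wzE]]] := taylorT.2 j.
exists (fun i => w i != w j), (fun i => z i != w j).
split; [by rewrite eqxx|by apply/eqP => /esym|].
move=> A VA g.
have := wzE A VA (fun k => g (k != w j)).
by rewrite !eval_eval !eval_subst.
Qed.

Lemma eta_reach_x : reach x.
Proof.
pose z' := con_meet (con_syn reach) collapse.
(* Below collapse, zeta is the largest congruence for which the z'-class of y is
   a union of classes. *)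
pose zeta := con_meet (con_syn (fun v => z' v y)) collapse.
have cxy := collapse_xy.
have eta_z' : con_le eta z'.
  move=> a b ab; split; last exact: eta_collapse.
  by apply: (@le_con_syn _ _ _ eta) => // u v; exact: reach_eta.
have z'c : con_le z' collapse by move=> a b [].
have z'_zeta : con_le z' zeta.
  move=> a b ab; split; last exact: z'c.
  apply: (@le_con_syn _ _ _ z') => // u v uv uy; exact: ctrans (csym uv) uy.
have /centralizesP Cz' := stable_collapse eta_z' z'c.
have /centralizesP Czeta : centralizes collapse collapse zeta.
  by apply: stable_collapse => [a b /eta_z' /z'_zeta|a b []].
have V_z' a b : eqV bool a b -> z' a b by move=> /eqV_eta /eta_z'.
pose le := syn reach.
have le_xy : le x y := syn_reach_xy.
(* Within [collapse], [z'] is the equivalence of the preorder [le], so its classes are convex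
   there. *)
have sandwich a b c : le a b -> le b c -> z' a c -> b ~ c -> z' b c.
  move=> ab bc [[ac ca] cac] cbc; split => //; split => //.
  exact: syn_trans ca ab.
have z'_le a b : z' a b -> le a b by case=> -[].
(* The generators inside the constants of f become arguments, so that they can be moved as well. *)
pose F f v a b : F2 := eval F2 (flat f) (oapp (pair a b) v).
have polE f v : pol f v = F f v x y.
  by rewrite pol_flat; congr eval; apply/funext => -[[]|].
have F_mat d f p q r s p' q' r' s' p'' q'' r'' s'' :
    mat collapse d p q r s -> mat collapse d p' q' r' s' ->
    mat collapse d p'' q'' r'' s'' ->
    mat collapse d (F f p p' p'') (F f q q' q'') (F f r r' r'') (F f s s' s'').
  by move=> *; apply: mat_eval => -[[]|].
have F_le f v a b v' a' b' : le v v' -> le a a' -> le b b' ->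
    le (F f v a b) (F f v' a' b').
  by move=> *; apply: syn_eval => -[[]|].
have F_con (d : congruence F2) f v a b v' a' b' : d v v' -> d a a' -> d b b' ->
    d (F f v a b) (F f v' a' b').
  by move=> *; apply: eval_con => -[[]|].
have F_yyy f v : v ~ y -> F f v x y ~ y -> eqV bool (F f y y y) y.
  move=> vy fvy; have : pol f y ~ y.
    rewrite polE; apply: ctrans fvy.
    by apply: F_con; [exact: csym|exact: crefl..].
  rewrite /collapse /= eval_flat (_ : oapp _ _ = oapp (pair y y) y) //.
  by apply/funext => -[[]|].
pose u j := T_ (fun i => if i == j then y else x).
have T_x : eqV bool (T_ (fun=> x)) x by exact: taylor_idem.
have T_y : eqV bool (T_ (fun=> y)) y by exact: taylor_idem.
have le_xu j : le x (u j).
  apply: syn_trans (z'_le _ _ (V_z' _ _ (csym T_x))) _.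
  by apply: syn_eval => i; case: ifP => _ //; exact: syn_refl.
have le_uy j : le (u j) y.
  apply: syn_trans (z'_le _ _ (V_z' _ _ T_y)).
  by apply: syn_eval => i; case: ifP => _ //; exact: syn_refl.
have cu j : u j ~ y.
  apply: ctrans (eqV_collapse T_y); apply: eval_con => i.
  by case: ifP => _ //; exact: crefl.
have zeta_xu j : zeta x (u j).
  split; last exact: ctrans cxy (csym (cu j)).
  split=> f; rewrite !polE => fy.
    (* Here f(u_j) is squeezed between f(x) and y. *)
    have Fy := F_yyy f x cxy (z'c _ _ fy).
    apply: (sandwich _ _ _ _ _ fy).
    - by apply: F_le => //; exact: syn_refl.
    - apply: syn_trans (z'_le _ _ (V_z' _ _ Fy)).
      by apply: F_le => //; exact: syn_refl.
    - apply: ctrans (z'c _ _ fy).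
      apply: F_con; [exact: ctrans (cu j) (csym cxy)|exact: crefl..].
  have Fy := F_yyy f _ (cu j) (z'c _ _ fy).
  have Fc v : v ~ y -> F f v y y ~ y.
    move=> vy; apply: ctrans (eqV_collapse Fy).
    by apply: F_con => //; exact: crefl.
  have le_Fy v : le v y -> le (F f v y y) y.
    move=> vy; apply: syn_trans (z'_le _ _ (V_z' _ _ Fy)).
    by apply: F_le => //; exact: syn_refl.
  have Fu : z' (F f (u j) y y) y.
    apply: (sandwich _ _ _ _ _ fy); [|exact: le_Fy|exact: Fc].
    by apply: F_le => //; exact: syn_refl.
  (* Abelianness modulo [z'] exchanges u_j for x in the first argument. It remains to relate
     F(x,y,y) to y. *)
  have Fxy : z' (F f x x y) (F f x y y).
    apply: Cz' (ctrans fy (csym Fu)).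
    apply: F_mat; [|exact: mat_col|exact: mat_cst].
    by apply: mat_row; exact: ctrans (cu j) (csym cxy).
  apply: ctrans Fxy _.
  have le_xb b : le x (Var b) by case: b => //; exact: syn_refl.
  have le_by b : le (Var b) y by case: b => //; exact: syn_refl.
  have cT (b : 'I_n -> bool) : T_ (fun i => Var (b i)) ~ y.
    apply: ctrans (eqV_collapse T_y); apply: eval_con => i.
    by case: (b i) => //; exact: crefl.
  have leT (b : 'I_n -> bool) : le (T_ (fun i => Var (b i))) y.
    apply: syn_trans (z'_le _ _ (V_z' _ _ T_y)).
    by apply: syn_eval => i; exact: le_by.
  have Fb (b : 'I_n -> bool) : b j -> z' (F f (T_ (fun i => Var (b i))) y y) y.
    move=> bj; apply: (sandwich _ _ _ _ _ Fu); [|exact/le_Fy|exact/Fc].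
    apply: F_le; [|exact: syn_refl..]; apply: syn_eval => i.
    by case: eqP => [->|_]; [rewrite bj; exact: syn_refl|exact: le_xb].
  pose c := T_ (fun i => if i == j then x else y).
  (* Start from the row T(x,..,y,..,x), T(y,..,y), whose images are both y modulo [z'], and change
     the j-th argument from y to x. *)
  have Fxc : z' (F f (T_ (fun=> x)) y y) (F f c y y).
    apply: Cz' (ctrans Fu (csym (Fb xpredT isT))).
    apply: F_mat; [|exact: mat_cst..]; apply: mat_eval => i.
    case: eqP => _; last exact: mat_col.
    exact: (mat_row _ (csym cxy)).
  have [w [z [wj zj wz]]] := taylor_identity j.
  have Fw : z' (F f (T_ (fun i => Var (w i))) y y) y.
    apply: ctrans (Fb z zj).
    by apply: F_con; [exact: V_z'|exact: crefl..].
  (* As w_j is x, T(w) lies between T(x,..,x) and c. As T(w) = T(z) with z_j = y, its image is also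
     y modulo [z']. *)
  have Fwc : z' (F f (T_ (fun i => Var (w i))) y y) (F f c y y).
    apply: (sandwich _ _ _ _ _ Fxc).
    - apply: F_le; [apply: syn_eval => i; exact: le_xb|exact: syn_refl..].
    - apply: F_le; [apply: syn_eval => i|exact: syn_refl..].
      by case: eqP => [->|_]; [rewrite wj; exact: syn_refl|exact: le_by].
    - apply: ctrans (Fc _ (cT w)) (csym (Fc _ _)).
      apply: ctrans (eqV_collapse T_y); apply: eval_con => i.
      by case: ifP => _ //; exact: crefl.
  apply: ctrans (ctrans Fxc (ctrans (csym Fwc) Fw)).
  by apply: F_con; [exact/csym/V_z'|exact: crefl..].
(* Since y is in its own [z']-class and in [reach], [zeta] puts x into that class, and then [z']
   puts x into [reach]. *)
suff : zeta x y.
  move=> [[_ /(_ (Var None) (crefl z' y))] + _] => -[[_ h] _].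
  exact: h (Var None) reach_y.
pose mix k := T_ (fun i : 'I_n => if i < k then y else x).
have V_zeta a b : eqV bool a b -> zeta a b by move=> /V_z' /z'_zeta.
suff h k : k <= n -> zeta x (mix k).
  apply: ctrans (h n (leqnn n)) (V_zeta _ _ _).
  by apply: taylor_idem => i; rewrite ltn_ord.
elim: k => [_|k IH lt_k].
  by apply: csym; apply: V_zeta; exact: taylor_idem.
apply: ctrans (IH (ltnW lt_k)) _.
(* The first row is T(x,..,x), u_k, related by [zeta]; the second is [mix k], [mix k.+1]. *)
apply: Czeta (ctrans (V_zeta _ _ T_x) (zeta_xu (Ordinal lt_k))).
apply: mat_eval => i; rewrite -(inj_eq val_inj) /= (ltnS i k) (leq_eqVlt i k).
case: (ltngtP i k) => _ /=.
- exact: mat_row.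
- exact: mat_cst.
- exact: mat_col.
Qed.

End Taylor.
(* A Maltsev operation turns reflexive compatible relations into congruences, so
   the congruence generated by a pair needs no transitive closure. *)
Lemma maltsev_generated (A : algebra S) (rho al : congruence A)
    (w : term S 'I_3) (p q : A) :
  con_le rho al -> al p q ->
  (forall a b, al a b -> rho (app3 A w a b b) a /\ rho (app3 A w a a b) b) ->
  exists z : congruence A, [/\ con_le rho z, con_le z al, z p q &
    forall a b, z a b ->
      exists f : term S (option A), rho a (pol f p) /\ rho b (pol f q)].
Proof.
move=> rho_al alpq M.
pose R a b := exists f : term S (option A), rho a (pol f p) /\ rho b (pol f q).
have R_al a b : R a b -> al a b.
  move=> [f [/rho_al af /rho_al bf]].
  exact: ctrans af (ctrans (pol_con _ alpq) (csym bf)).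
have R_sat a b a' b' : rho a' a -> rho b' b -> R a b -> R a' b'.
  by move=> ha hb [f [fa fb]]; exists f; split; [exact: ctrans fa|exact: ctrans fb].
have R_refl a : R a a by exists (Var (Some a)); split; exact: crefl.
have R_eval I (t : term S I) (e e' : I -> A) :
    (forall i, R (e i) (e' i)) -> R (eval A t e) (eval A t e').
  move=> /choice[g gP]; exists (subst t g); rewrite /pol !eval_subst.
  by split; apply: eval_con => i; case: (gP i).
have R_app3 a b c a' b' c' : R a a' -> R b b' -> R c c' ->
    R (app3 A w a b c) (app3 A w a' b' c').
  by move=> *; apply: R_eval => -[[|[|[|//]]] h].
have R_sym a b : R a b -> R b a.
  move=> Rab; have [m1 m2] := M _ _ (R_al _ _ Rab).
  (* Apply w to the pairs (a,a), (a,b), (b,b). *)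
  by apply: R_sat (csym m2) (csym m1) _; exact: R_app3.
have R_trans a b c : R a b -> R b c -> R a c.
  move=> Rab Rbc; have [m1 _] := M _ _ (R_al _ _ Rab).
  have [_ m2] := M _ _ (R_al _ _ Rbc).
  by apply: R_sat (csym m1) (csym m2) _; exact: R_app3.
have R_op (f : sym S) (a b : 'I_(arity f) -> A) :
    (forall i, R (a i) (b i)) -> R (op a) (op b).
  exact: (R_eval _ (App f (fun i => Var i))).
exists (Congruence R_refl R_sym R_trans R_op); split=> //.
- by move=> a b ab; apply: R_sat (R_refl b) => //; exact: crefl.
- by exists (Var None); split; exact: crefl.
Qed.

(** * Making the left identity exact *)

Section Exact.
Hypothesis stable : weakly_stable_third V.
Variable w : term S 'I_3.
Hypotheses (w_xxy : w⟨x, x, y⟩ ≡ y) (w_xyy : w⟨x, y, y⟩ ≡ x).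

Notation F3 := (term_algebra S 'I_3).
Notation X := (Var (@Ordinal 3 0 isT) : F3).
Notation Y := (Var (@Ordinal 3 1 isT) : F3).
Notation Z := (Var (@Ordinal 3 2 isT) : F3).

(** Under (x,y,z) |-> (x,x,y) the relations become identities of V; under (x,y,z) |-> (x,y,y) they
    become relations modulo [eta]. *)
Lemma generators_related : exists f : term S (option F3),
  let al := preimage_con (@eval_hom S _ F2 (vec3 x x y)) (eqV bool) in
  let de := preimage_con (@eval_hom S _ F2 (vec3 x y y)) eta in
  let rho := con_meet al de in
  rho X (pol f (app3 F3 w Z Z X)) /\ rho Y (pol f (app3 F3 w Z Z Y)).
Proof.
set al := preimage_con _ _; set de := preimage_con _ _.
(* Modulo the identities of V, [al] is generated by (X,Y), and [ga] by identifying all three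
   generators. *)
pose ga := preimage_con (@eval_hom S _ F2 (vec3 x y y)) collapse.
pose rho := con_meet al de.
have al_ga : con_le al ga.
  move=> s t /eqV_collapse; rewrite /= !eval_eval.
  rewrite (_ : (fun i => eval F2 (vec3 x x y i) (fun=> y)) =
               (fun i => eval F2 (vec3 x y y i) (fun=> y))) //.
  by apply/funext => -[[|[|[|//]]] h].
have Cde : centralizes ga ga de.
  by apply: centralizes_preimage; exact: centralizes_eta.
have Crho : centralizes ga al rho.
  apply: centralizes_meet; first exact: centralizes_self.
  by apply: centralizes_anti Cde.
have Crho' : centralizes al al rho by exact: centralizes_anti Crho.
have V_rho : con_le (eqV 'I_3) rho.
  by move=> s t h; split; [exact: eqV_eval|exact/eqV_eta/eqV_eval].
have rho_al : con_le rho al by move=> a b [].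
(* As [al] is abelian modulo [rho], the relations for w modulo [eta] carry over to pairs in [al]. *)
have M a b : al a b -> rho (app3 F3 w a b b) a /\ rho (app3 F3 w a a b) b.
  move=> ab; have eta_rho s t : s ≡ t ->
      rho (eval F3 s (pair a b)) (eval F3 t (pair a b)).
    apply: eta_eval rho_al Crho' _ => // {}s {}t h.
    exact/V_rho/eqV_eval.
  by have := eta_rho _ _ w_xyy; have := eta_rho _ _ w_xxy; rewrite !eval_app3.
have alXY : al X Y by exact: crefl.
have al_pq : al (app3 F3 w Z Z X) (app3 F3 w Z Z Y).
  by apply: app3_con => //; exact: crefl.
have [z [rho_z z_al zpq zE]] := maltsev_generated rho_al al_pq M.
apply: zE.
have Cz : centralizes ga al z.
  apply: (weakly_stable_above stable (free_in_variety 'I_3) V_rho Crho rho_z).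
  by move=> a b /z_al ab; split => //; exact: al_ga.
have gaZX : ga Z X by exact: (csym collapse_xy).
(* Exchanging Z for X turns the generating pair into w(X,X,X), w(X,X,Y), which are X and Y modulo
   [rho]. *)
have N : mat ga al (app3 F3 w Z Z X) (app3 F3 w Z Z Y)
    (app3 F3 w X X X) (app3 F3 w X X Y).
  by apply: app3_mat; [exact: mat_row|exact: mat_row|exact: mat_col].
have /centralizesP /(_ _ _ _ _ N zpq) h := Cz.
have wXX : rho (app3 F3 w X X X) X by case: (M X X (crefl _ _)).
have wXY : rho (app3 F3 w X X Y) Y by case: (M X Y alXY).
exact: ctrans (csym (rho_z _ _ wXX)) (ctrans h (rho_z _ _ wXY)).
Qed.

Lemma exact_difference_term :
  exists d : term S 'I_3, eqV bool d⟨x, x, y⟩ y /\ d⟨x, y, y⟩ ≡ x.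
Proof.
have [f [[A B1] [_ B2]]] := generators_related.
pose G v a b c : F2 := eval F2 (flat f) (oapp (vec3 a b c) v).
have G_con (d : congruence F2) v a b c v' a' b' c' :
    d v v' -> d a a' -> d b b' -> d c c' -> d (G v a b c) (G v' a' b' c').
  by move=> *; apply: eval_con => -[[[|[|[|//]]] h]|].
have G_mat p q r s a b c d a' b' c' d' a'' b'' c'' d'' :
    mat collapse collapse p q r s -> mat collapse collapse a b c d ->
    mat collapse collapse a' b' c' d' -> mat collapse collapse a'' b'' c'' d'' ->
    mat collapse collapse (G p a a' a'') (G q b b' b'') (G r c c' c'')
      (G s d d' d'').
  by move=> *; apply: mat_eval => -[[[|[|[|//]]] h]|].
have fE u a b c :
    eval F2 (pol f (app3 F3 w Z Z u)) (vec3 a b c) =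
    G w⟨c, c, eval F2 u (vec3 a b c)⟩ a b c.
  by rewrite eval_flat eval_app3.
have {}A : eqV bool x (G w⟨y, y, x⟩ x x y) by rewrite -(fE X).
have {}B1 : x ≡ G w⟨y, y, x⟩ x y y by rewrite -(fE X).
have {}B2 : y ≡ G w⟨y, y, y⟩ x y y by rewrite -(fE Y).
have A_sub a b : eqV bool a (G w⟨b, b, a⟩ a a b).
  have := eqV_eval (pair a b) A; rewrite /G eval_eval /=.
  rewrite (_ : (fun _ => _) = oapp (vec3 a a b) w⟨b, b, a⟩) //.
  by apply/funext => -[[[|[|[|//]]] h]|] //=; rewrite eval_app3.
(* With this choice d(x,x,y) is the right side of [A_sub y x], hence equal to y in V. *)
pose d : term S 'I_3 := eval F3 (flat f) (oapp (vec3 Z Z X) w).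
have dE a b c : d⟨a, b, c⟩ = G w⟨a, b, c⟩ c c a.
  rewrite /app3 /d eval_eval; congr eval.
  by apply/funext => -[[[|[|[|//]]] h]|].
exists d; rewrite !dE; split; first exact: csym (A_sub y x).
have /centralizesP C := centralizes_eta.
have cxy := collapse_xy; have cyx := csym cxy.
have wl u v : u ~ v -> w⟨u, u, v⟩ ≡ v by exact: eta_app3.
have G_v v v' a b c : v ≡ v' -> G v a b c ≡ G v' a b c.
  by move=> vv'; apply: G_con => //; exact: crefl.
have Gyyyx : G y y y x ≡ y.
  apply: ctrans (csym (eqV_eta (A_sub y x))).
  by apply: G_v; exact/csym/wl.
have Gyyyy : G y y y y ≡ y.
  apply: ctrans (csym (eqV_eta (A_sub y y))).
  by apply: G_v; exact/csym/wl/crefl.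
have Gxxyy : G x x y y ≡ x.
  by apply: ctrans _ (csym B1); apply: G_v; apply: csym; exact: wl.
have Gyxyy : G y x y y ≡ y.
  by apply: ctrans _ (csym B2); apply: G_v; apply: csym; exact/wl/crefl.
(* What remains is G(x,y,y,x) ≡ x. The term condition changes the first argument from y to x in two
   relations between values that are y modulo [eta], giving a chain through G(x,y,y,y) to G(x,x,y,y)
   ≡ x. *)
have E1 : G x y y x ≡ G x y y y.
  apply: C (ctrans Gyyyx (csym Gyyyy)).
  by apply: G_mat; [exact: mat_row|exact: mat_cst|exact: mat_cst|exact: mat_col].
have E2 : G x x y y ≡ G x y y y.
  apply: C (ctrans Gyxyy (csym Gyyyy)).
  by apply: G_mat; [exact: mat_row|exact: mat_col|exact: mat_cst|exact: mat_cst].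
apply: ctrans (G_v _ _ _ _ _ w_xyy) _.
exact: ctrans E1 (ctrans (csym E2) Gxxyy).
Qed.

End Exact.

Lemma stable_difference_term :
  weakly_stable_third V -> has_taylor_term V -> has_difference_term V.
Proof.
move=> stable [n [T hT]].
have [w [w_xxy w_xyy]] := eta_reach_x stable hT.
have [d [dl dr]] := exact_difference_term stable w_xxy w_xyy.
exists d; split.
  move=> A VA e; rewrite eval_subst_vec3 /=.
  by have := dl A VA (pair (e 0) (e 1)); rewrite eval_app3.
move=> B VB a p q /abelian_conP Ca apq.
(* Since a is abelian, relations modulo [eta] hold as equalities at pairs in a. *)
have := @eta_eval B a (con_zero B) (pair p q) _ _ _ _ Ca apq dr.
rewrite eval_app3; apply.
- by move=> s t h; exact: h.
- by move=> u v ->; exact: crefl.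
Qed.

End Free.

Theorem theorem4p44 (S : signature) (V : algebra S -> Prop)
    (hV : is_variety V) (hT : has_taylor_term V) :
  has_difference_term V <-> weakly_stable_third V.
Proof.
split; first exact: difference_term_stable.
by move=> stable; exact: stable_difference_term.
Qed.
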